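(* Let $\alpha\in(0,1)$ and $c>1$. Set $\hat T(e^{-s})=\sum_{n=0}^\infty T_n e^{-sn}$, $s>0$, where $T_n$, $n\ge 0$, are uniformly bounded positive operators on some Banach space $\mathcal{B}$ with norm $\|\cdot\|$. Let $P:\mathcal{B}\to\mathcal{B}$ be a bounded linear operator. Assume that $$\hat T(e^{-s})\sim \frac{1}{s^\alpha\ell(1/s) q_0(s)} P \quad \text{as } s\to 0,$$ for some slowly varying function $\ell$ and some $q_0:(0,\infty)\to(0,\infty)$ with $1/q_0 \in \mathcal{Q}_{c^{1/\alpha}, \alpha}$. Let $p= \mathrm{A}_\alpha^{-1} (1/ q_0)$. Then for all $z\in C_p$, as $n\to\infty$, $$\sum_{j=0}^{ \lfloor c^{n/\alpha}z \rfloor} T_j \sim \frac{c^n z^\alpha}{\ell(c^{n/\alpha} z)} \, p(z)\, P.$$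
   Context: For bounded operators $T(x),P$ acting on a Banach space $\mathcal{B}$ with norm $\|\cdot\|$ and a positive scalar function $c(x)$, the notation $T(x)\sim c(x)P$ means $\|T(x)-c(x)P\|=o(c(x))$. An operator on $\mathcal{B}$ is positive if it maps nonnegative elements of $\mathcal{B}$ to nonnegative elements. A function $\ell$ is slowly varying if it is slowly varying at infinity. $\lfloor\cdot\rfloor$ is the lower integer part, and $C_p$ is the set of continuity points of $p$ in $(0,\infty)$. For $r>1$, $\mathcal{P}_r$ is the set of functions $p:(0,\infty)\to(0,\infty)$ that are bounded, right-continuous, satisfy $\inf_{x\in[1,r]}p(x)>0$, and $p(xr)=p(x)$ for all $x>0$. For $\rho\ge0$, $\mathcal{P}_{r,\rho}$ is the set of $p\in\mathcal{P}_r$ such that $x^\rho p(x)$ is nondecreasing, and $\mathcal{Q}_{r,\rho}$ is the set of functions $q\in\mathcal{P}_r$ such that $s^{-\rho}q(s)$ is completely monotone. For $\rho>0$ the operator $\mathrm{A}_\rho:\mathcal{P}_{r,\rho}\to\mathcal{Q}_{r,\rho}$ is defined by $$\mathrm{A}_\rho p(s)=s^\rho\int_0^\infty e^{-sx}\,\mathrm{d}(p(x)x^\rho);$$ it is known to be one-to-one, and $\mathrm{A}_\rho^{-1}$ denotes its inverse.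
   Formalization: The Banach space is taken real, and its nonnegative elements are assumed to form a closed, generating, normal cone (as in any Banach lattice); without such a link between order and norm the claim is false, e.g. for the pointwise order on C^1[0,1]. *)

(* Defs.v *)
From HB Require Import structures.
From mathcomp Require Import all_boot all_order all_algebra.
From mathcomp Require Import all_classical all_reals all_analysis.
Set Implicit Arguments.
Unset Strict Implicit.
Unset Printing Implicit Defensive.
Import Order.TTheory GRing.Theory Num.Theory.
Import numFieldNormedType.Exports.
Local Open Scope classical_set_scope.
Local Open Scope ring_scope.

(* Functions on (0, +oo) are represented by functions R -> R; every condition
   below constrains them on positive arguments only. *)

Section OrderedBanach.
Context {R : realType} {B : completeNormedModType R}.

(* K is the set of nonnegative elements of B. Generating and normal are what
   make 0 <= S <= T imply ||S|| <= C ||T|| for operators; the positive cone of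
   any Banach lattice (L^p, C(X), spaces of bounded functions) satisfies all of
   these conditions. *)
Record nonneg_cone (K : set B) : Prop := {
  cone0 : K 0;
  coneD : forall x y, K x -> K y -> K (x + y);
  coneZ : forall (a : R) x, 0 <= a -> K x -> K (a *: x);
  cone_pointed : forall x, K x -> K (- x) -> x = 0;
  cone_closed : closed K;
  cone_generating : forall x, exists u v, [/\ K u, K v & x = u - v];
  cone_normal : exists C : R,
    forall x y, K x -> K (y - x) -> `|x| <= C * `|y| }.

Definition positive_op (K : set B) (T : B -> B) : Prop :=
  forall x, K x -> K (T x).

(* A real supremum: meaningful for bounded linear T only. *)
Definition opnorm (T : B -> B) : R :=
  sup [set `|T x| | x in [set x : B | `|x| <= 1]].

Definition uniformly_bounded (T : nat -> {linear B -> B}) : Prop :=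
  (forall n, continuous (T n)) /\ exists M : R, forall n, opnorm (T n) <= M.

(* T(x) ~ c(x) P along F, i.e. ||T(x) - c(x) P|| = o(c(x)), for c positive
   eventually along F. *)
Definition op_equiv (X : Type) (F : set_system X)
    (T : X -> B -> B) (c : X -> R) (P : B -> B) : Prop :=
  forall eps : R, 0 < eps ->
    \forall x \near F, opnorm (fun v => T x v - c x *: P v) <= eps * c x.

Definition laplace_op (T : nat -> {linear B -> B}) (s : R) : B -> B :=
  fun v => limn (series (fun n => expR (- s * n%:R) *: T n v)).

End OrderedBanach.

Section LogPeriodic.
Context {R : realType}.
Implicit Types (p q l f : R -> R) (r rho : R).

Definition slowly_varying l : Prop :=
  (exists X : R, measurable_fun `[X, +oo[ l /\ forall x, X <= x -> 0 < l x) /\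
  forall a : R, 0 < a -> l (a * x) / l x @[x --> +oo] --> (1 : R).

Record Pr r p : Prop := {
  Pr_gt0 : forall x, 0 < x -> 0 < p x;
  Pr_bounded : exists M : R, forall x, 0 < x -> p x <= M;
  Pr_right_continuous : forall x, 0 < x -> p y @[y --> x^'+] --> p x;
  Pr_inf : 0 < inf (p @` `[1, r]);
  Pr_period : forall x, 0 < x -> p (x * r) = p x }.

Record Prho r rho p : Prop := {
  Prho_Pr : Pr r p;
  Prho_nd : forall x y, 0 < x -> x <= y ->
    x `^ rho * p x <= y `^ rho * p y }.

Definition completely_monotone f : Prop :=
  forall (n : nat) (s : R), 0 < s ->
    derivable (derive1n n f) s 1 /\ 0 <= (-1) ^+ n * derive1n n f s.

Definition Qrho r rho q : Prop :=
  Pr r q /\ completely_monotone (fun s => s `^ (- rho) * q s).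

Section Stieltjes.
Variables (r rho : R) (rho_gt0 : 0 < rho) (p : R -> R) (pP : Prho r rho p).

(* x |-> p(x) x^rho extended by its limit 0 at 0+, so that dF has no mass
   outside (0, +oo). *)
Definition stieltjes_fun of 0 < rho & Prho r rho p : R -> R :=
  fun x => if 0 < x then p x * x `^ rho else 0.

Let F := stieltjes_fun rho_gt0 pP.

Lemma stieltjes_fun_nd : nondecreasing F.
Proof.
move=> x y xy; rewrite /F /stieltjes_fun.
case: ifPn => [x0|_].
  rewrite (lt_le_trans x0 xy) ![p _ * _]mulrC.
  exact: (Prho_nd pP).
case: ifPn => // y0; apply: mulr_ge0; last exact: powR_ge0.
exact/ltW/(Pr_gt0 (Prho_Pr pP)).
Qed.

Lemma stieltjes_fun_rc : right_continuous F.
Proof.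
move=> x; have [x0|x0|->] := ltgtP x 0.
- have -> : F x = 0 by rewrite /F /stieltjes_fun ltNge (ltW x0).
  apply: cvg_near_cst; near=> y.
  have y0 : y < 0 by near: y; exact: nbhs_right_lt.
  by rewrite /F /stieltjes_fun ltNge (ltW y0).
- have -> : F x = p x * x `^ rho by rewrite /F /stieltjes_fun x0.
  apply: (@cvg_trans _ ((fun y => p y * y `^ rho) @ x^'+)).
    apply: near_eq_cvg; near=> y.
    have xy : x < y by near: y; exact: nbhs_right_gt.
    by rewrite /F /stieltjes_fun (lt_trans x0 xy).
  apply: cvgM; first exact: (Pr_right_continuous (Prho_Pr pP)).
  apply: cvg_at_right_filter.
  have /derivable1_diffP/differentiable_continuous :
      derivable ((@powR R)^~ rho) x 1.
    by apply: derivable_powR; rewrite in_itv/= x0.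
  exact.
- have -> : F 0 = 0 by rewrite /F /stieltjes_fun ltxx.
  have [M pM] := Pr_bounded (Prho_Pr pP).
  apply: (@squeeze_cvgr _ _ _ _ (cst 0) (fun y => M * y `^ rho)).
  + near=> y.
    have y0 : 0 < y by near: y; exact: nbhs_right_gt.
    rewrite /F /stieltjes_fun y0 /= mulr_ge0 ?powR_ge0 ?ler_wpM2r ?powR_ge0 ?pM//.
    exact/ltW/(Pr_gt0 (Prho_Pr pP)).
  + exact: cvg_cst.
  + have -> : nbhs (0 : R) = nbhs (M * 0) by rewrite mulr0.
    apply: cvgM; first exact: cvg_cst.
    exact: powR_cvg0.
Unshelve. all: by end_near.
Qed.

HB.instance Definition _ := isCumulative.Build R _ R
  (stieltjes_fun rho_gt0 pP) stieltjes_fun_nd stieltjes_fun_rc.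

Definition Aop (s : R) : R :=
  s `^ rho * \int[lebesgue_stieltjes_measure (stieltjes_fun rho_gt0 pP)]_(x in
    `]0, +oo[) expR (- s * x).

End Stieltjes.

(* p = A_rho^{-1} q: p is the (unique) element of P_{r,rho} mapped to q. *)
Definition is_Aop_inv r rho (rho_gt0 : 0 < rho) q p : Prop :=
  exists pP : Prho r rho p, forall s, 0 < s -> Aop rho_gt0 pP s = q s.

(* C_p *)
Definition cont_points p : set R := [set z | 0 < z /\ {for z, continuous p}].

End LogPeriodic.

(* Main.v *)
Require Import Defs.
From mathcomp Require Import all_boot all_order all_algebra.
From mathcomp Require Import all_classical all_reals all_analysis.
From mathcomp Require Import measurable_realfun ring lra.
Set Implicit Arguments.
Unset Strict Implicit.
Unset Printing Implicit Defensive.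
Import Order.TTheory GRing.Theory Num.Theory.
Import numFieldNormedType.Exports.
Local Open Scope classical_set_scope.
Local Open Scope ring_scope.

(* Karamata's method. Put F(x) = p(x) x^alpha, x_n = c^(n/alpha) z and
   g_n = c^n / l(x_n). As q_0 is log-periodic and l slowly varying, the
   hypothesis at s = (k+1)/x_n says that the Laplace sums of T divided by g_n
   converge in norm to (int e^{-(k+1)x/z} dF(x)) P. By linearity the same holds
   with e^{-u} Q(e^{-u}) in place of e^{-(k+1)u}, for every polynomial Q. The
   indicator of u <= 1 lies between two such functions whose integrals against
   dF(z u) are arbitrarily close, because F is continuous at z; positivity of
   the T_j and normality of the cone turn this into a norm estimate for the
   partial sums. *)

(** * Polynomials in e^-t approximating a step *)

(** The outer factor e^-t and the decaying bound [eta * expR (- t)] beyond [b] keep the error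
    integrable against measures of infinite total mass, where a constant bound [eta] would be
    useless. *)
Lemma poly_step (R : realType) (a b eta : R) :
  0 < a -> a < b -> 0 < eta -> exists Q : {poly R}, forall t, 0 <= t ->
  [/\ 0 <= expR (- t) * Q.[expR (- t)] <= 1,
      t <= a -> 1 - eta <= expR (- t) * Q.[expR (- t)] &
      b <= t -> expR (- t) * Q.[expR (- t)] <= eta * expR (- t)].
Proof.
move=> a0 ab eta0.
have [N etaN] : exists N : nat, expR (- N%:R) <= eta.
  exists (Num.truncn (- ln eta)).+1.
  rewrite -[leRHS]lnK ?posrE// ler_expR lerNl.
  exact/ltW/truncnS_gt.
have [k etak] : exists k : nat,
    (N%:R + 1) * expR (a *+ k.+1) * expR (- (b *+ k)) <= eta.
  (* Taking logarithms, the condition reads k (b - a) >= ln (N + 1) + a - ln eta, which is solvable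
     because a < b. *)
  pose y := (ln (N%:R + 1) + a - ln eta) / (b - a).
  exists (Num.truncn y).+1.
  rewrite -[leRHS]lnK ?posrE// -[X in X * _ * _]lnK ?posrE ?ltr_wpDl//.
  rewrite -!expRD ler_expR.
  have : y <= (Num.truncn y).+1%:R by exact/ltW/truncnS_gt.
  rewrite ler_pdivrMr ?subr_gt0// mulrS -(mulr_natl a) -(mulr_natl b).
  lra.
pose m := (Num.truncn (N%:R * expR (a *+ k.+1))).+1.
have m_ge : N%:R * expR (a *+ k.+1) <= m%:R by exact/ltW/truncnS_gt.
have m_le : m%:R <= (N%:R + 1) * expR (a *+ k.+1).
  rewrite mulrDl mul1r -natr1 lerD//.
    by rewrite truncn_le// mulr_ge0// expR_ge0.
  rewrite -expR0 ler_expR; exact/mulrn_wge0/ltW.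
(* u Q(u) = 1 - (1 - u^(k+1))^m with m about N e^(a(k+1)): large enough for
   (1 - u^(k+1))^m <= e^-N when u >= e^-a, and small enough for
   m u^(k+1) <= eta u when u <= e^-b. *)
exists ('X^k * \sum_(i < m) (1 - 'X^(k.+1)) ^+ i) => t t0.
set u := expR (- t).
have u0 : 0 < u by exact: expR_gt0.
have u1 : u <= 1 by rewrite -expR0 ler_expR oppr_le0.
have uk0 : 0 < u ^+ k.+1 by rewrite exprn_gt0.
have uk1 : u ^+ k.+1 <= 1 by rewrite exprn_ile1// ltW.
pose w := 1 - u ^+ k.+1.
have w0 : 0 <= w by rewrite subr_ge0.
have w1 : w <= 1 by rewrite gerBl ltW.
have QE : u * ('X^k * \sum_(i < m) (1 - 'X^(k.+1)) ^+ i).[u] =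
    u ^+ k.+1 * \sum_(i < m) w ^+ i.
  rewrite hornerM hornerXn mulrA -exprS horner_sum; congr (_ * _).
  by apply: eq_bigr => i _; rewrite horner_exp !hornerE.
have QE' : u * ('X^k * \sum_(i < m) (1 - 'X^(k.+1)) ^+ i).[u] = 1 - w ^+ m.
  by rewrite QE -[RHS]opprB subrX1 -mulNr opprB subKr.
have wm0 : 0 <= w ^+ m by rewrite exprn_ge0.
have wm1 : w ^+ m <= 1 by rewrite exprn_ile1.
split.
- by rewrite QE' subr_ge0 wm1 gerBl.
- move=> ta; rewrite QE' lerB// (le_trans _ etaN)//.
  apply: (@le_trans _ _ (expR (- u ^+ k.+1) ^+ m)).
    rewrite lerXn2r ?nnegrE ?expR_ge0//.
    exact: expR_ge1Dx.
  rewrite -expRM_natr ler_expR mulNr lerN2.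
  apply: (@le_trans _ _ (expR (- a) ^+ k.+1 * m%:R)); last first.
    rewrite ler_wpM2r// lerXn2r ?nnegrE ?expR_ge0//.
    by rewrite ler_expR lerN2.
  rewrite -expRM_natr mulNr (mulr_natr a) expRN [leRHS]mulrC.
  by rewrite ler_pdivlMr ?expR_gt0.
(* One factor u is kept for the decay. The remaining u^k is at most e^(-bk) and the geometric sum
   has m terms, each at most 1, so [m_le] and [etak] bound the product. *)
- move=> bt; rewrite QE exprS mulrC mulrCA [leLHS]mulrC ler_wpM2r ?(ltW u0)//.
  apply: le_trans etak.
  apply: (@le_trans _ _ (m%:R * expR (- b) ^+ k)).
    apply: ler_pM => //.
    + by apply: sumr_ge0 => i _; rewrite exprn_ge0.
    + by rewrite exprn_ge0// ltW.
    + rewrite -[leRHS]mulr_natl mulr1 -[X in _ <= X%:R]card_ord -sumr_const.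
      by apply: ler_sum => i _; rewrite exprn_ile1.
    + by rewrite lerXn2r ?nnegrE ?expR_ge0// ler_expR lerN2.
  rewrite -expRM_natr mulNr (mulr_natr b).
  by rewrite ler_wpM2r// expR_ge0.
Qed.

(** Take one step falling just before 1 and one falling just after. Subtracting h e^-t makes the
    first nonpositive beyond 1; adding h e^(1-t), which is at least h for t <= 1, lifts the second
    above 1 there. Only in the window around 1 can the two differ substantially. *)
Lemma step_sandwich (R : realType) (delta eta : R) :
  0 < delta < 1 -> 0 < eta -> exists A B : {poly R}, forall t, 0 <= t ->
  [/\ expR (- t) * A.[expR (- t)] <= (t <= 1)%R%:R,
      (t <= 1)%R%:R <= expR (- t) * B.[expR (- t)] &
      expR (- t) * B.[expR (- t)] - expR (- t) * A.[expR (- t)] <=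
      eta * expR (- t) + (1 - delta < t <= 1 + delta)%R%:R].
Proof.
move=> /andP[d0 d1] eta0.
set e := expR (1 : R).
have e0 : 0 < e by exact: expR_gt0.
(* The shifts and the approximation errors add up to at most 2h (1 + e) e^-t outside the window. *)
pose h := eta / ((1 + e) *+ 2).
have h0 : 0 < h by rewrite divr_gt0// pmulrn_rgt0// addr_gt0.
have hE : h + h + h * e + h * e = eta.
  by rewrite /h; field; rewrite lt0r_neq0// addr_gt0.
have [A hA] := @poly_step R (1 - delta) 1 h ltac:(lra) ltac:(lra) h0.
have [B hB] := @poly_step R 1 (1 + delta) h ltac:(lra) ltac:(lra) h0.
exists (A - h%:P), (B + (h * e)%:P) => t t0.
have [/andP[A0 A1] Aa Ab] := hA t t0.
have [/andP[B0 B1] Ba Bb] := hB t t0.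
rewrite !hornerE !mulrBr !mulrDr.
set u := expR (- t) in A0 A1 Aa Ab B0 B1 Ba Bb *.
have u0 : 0 < u by exact: expR_gt0.
have hu0 : 0 < h * u by rewrite mulr_gt0.
have heu : 0 < h * e * u by rewrite mulr_gt0// mulr_gt0.
have eu1 : t <= 1 -> h <= h * e * u.
  move=> t1; rewrite -mulrA ler_peMr ?(ltW h0)// -expRD -[leLHS]expR0 ler_expR.
  lra.
have etaE : eta * u = h * u + h * u + h * e * u + h * e * u by rewrite -hE; ring.
rewrite etaE ![u * (_ * e)]mulrC ![u * h]mulrC.
set xA := u * _ in A0 A1 Aa Ab *; set xB := u * _ in B0 B1 Ba Bb *.
have [t1|t1] := leP t 1.
- have {}Ba := Ba t1; have {}eu1 := eu1 t1; split=> /=; try lra.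
  have [td|td] := leP t (1 - delta).
    have {}Aa := Aa td.
    case: (_ && _) => /=; lra.
  have -> : t <= 1 + delta by lra.
  rewrite /=; lra.
- have {}Ab := Ab (ltW t1); split => /=; try lra.
  have -> : 1 - delta < t by lra.
  rewrite /=.
  have [td|td] := leP t (1 + delta); first by rewrite /=; lra.
  have {}Bb := Bb (ltW td); rewrite /=; lra.
Qed.

(** * Laplace transforms of Stieltjes measures *)

Section laplace_poly.
Variables (R : realType) (mu : {measure set (measurableTypeR R) -> \bar R}).
Local Notation D := (`]0, +oo[%classic : set (measurableTypeR R)).

Let measurableD : measurable D. Proof. exact: measurable_itv. Qed.

Let integrable_scale (k : R) (f : R -> R) :
  mu.-integrable D (fun x => (f x)%:E) -> mu.-integrable D (fun x => (k * f x)%:E).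
Proof. by move=> fi; have := integrableZl measurableD k fi; apply. Qed.

Definition laplace (s : R) : R := \int[mu]_(x in D) expR (- s * x).

(** A combination of Laplace values, matching [laplace_op_poly] term by term. The index k + 1 comes
    from the outer factor in e^-t Q(e^-t), whose integral at t = x / z this is. *)
Definition laplace_poly (z : R) (Q : {poly R}) : R :=
  \sum_(k < size Q) Q`_k * laplace (k.+1%:R / z).

Hypothesis int_exp : forall s, 0 < s ->
  mu.-integrable D (fun x => (expR (- s * x))%:E).

Let exp_horner (z x : R) (Q : {poly R}) :
  expR (- (x / z)) * Q.[expR (- (x / z))] =
  \sum_(k < size Q) Q`_k * expR (- (k.+1%:R / z) * x).
Proof.
rewrite horner_coef mulr_sumr; apply: eq_bigr => k _.
rewrite mulrCA -exprS -expRM_natr; congr (_ * expR _).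
ring.
Qed.

Lemma integrable_exp_horner (z : R) (Q : {poly R}) : 0 < z ->
  mu.-integrable D (fun x => (expR (- (x / z)) * Q.[expR (- (x / z))])%:E).
Proof.
move=> z0.
rewrite (_ : (fun _ => _) = fun x => (\sum_(k < size Q)
    (Q`_k * expR (- (k.+1%:R / z) * x))%:E)%E); last first.
  by apply/funext => x; rewrite exp_horner sumEFin.
apply: integrable_sum => // k _ /=.
by apply: integrable_scale; apply: int_exp; rewrite divr_gt0.
Qed.

Lemma laplace_polyE (z : R) (Q : {poly R}) : 0 < z ->
  laplace_poly z Q = \int[mu]_(x in D) (expR (- (x / z)) * Q.[expR (- (x / z))]).
Proof.
move=> z0.
have inte (k : 'I_(size Q)) : mu.-integrable D (fun x => (expR (- (k.+1%:R / z) * x))%:E).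
  by apply: int_exp; rewrite divr_gt0.
transitivity (\int[mu]_(x in D)
    (\sum_(k < size Q) Q`_k * expR (- (k.+1%:R / z) * x))); last first.
  by apply: eq_Rintegral => x _; rewrite exp_horner.
rewrite /Rintegral; under eq_integral do rewrite -sumEFin.
rewrite integral_sum//; last first.
  by move=> k; exact: integrable_scale.
rewrite /laplace_poly -[LHS]/(fine (_%:E)) -sumEFin; congr fine.
apply: eq_bigr => k _; rewrite EFinM /laplace /Rintegral fineK; last first.
  exact: integrable_fin_num.
by rewrite -integralZl.
Qed.

End laplace_poly.

(** * Laplace bounds for increments of a distribution function *)

Section stieltjes_laplace.
Variables (R : realType) (F : cumulative R R).
Let mu : {measure set (measurableTypeR R) -> \bar R} := lebesgue_stieltjes_measure F.
Local Notation D := (`]0, +oo[%classic : set (measurableTypeR R)).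

Let measurableD : measurable D. Proof. exact: measurable_itv. Qed.

Lemma lebesgue_stieltjes_itvoc (a b : R) : a <= b ->
  mu `]a, b]%classic = (F b - F a)%:E.
Proof.
move=> ab; rewrite /mu/= /lebesgue_stieltjes_measure /measure_extension.
rewrite measurable_mu_extE/=; last exact: is_ocitv.
by rewrite wlength_itv_bnd// ge0_cp.
Qed.

Let integrable_indic_oc (a b : R) : 0 <= a <= b ->
  mu.-integrable D (fun x => (\1_`]a, b] x)%:E).
Proof.
move=> /andP[a0 ab]; apply/integrableP; split.
  by apply/measurable_EFinP; apply: measurable_indic; exact: measurable_itv.
under eq_integral do rewrite gee0_abs ?lee_fin//.
rewrite integral_indic//.
rewrite (@le_lt_trans _ _ (mu `]a, b]%classic))//.
  by apply: le_measure; rewrite ?inE//; exact: measurableI.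
by rewrite lebesgue_stieltjes_itvoc// ltry.
Qed.

Let Rintegral_indic_oc (a b : R) : 0 <= a <= b ->
  \int[mu]_(x in D) \1_`]a, b] x = F b - F a.
Proof.
move=> /andP[a0 ab]; rewrite /Rintegral integral_indic//.
rewrite (_ : _ `&` _ = `]a, b]%classic) ?lebesgue_stieltjes_itvoc//.
apply/setIidPl => x /=; rewrite !in_itv/= andbT => /andP[ax _].
exact: le_lt_trans ax.
Qed.

Hypothesis int_exp : forall s, 0 < s ->
  mu.-integrable D (fun x => (expR (- s * x))%:E).

(** Under t = x / z the indicator of t <= 1 becomes that of ]0, z], with integral F z - F 0, and the
    window around 1 becomes an interval around z whose measure is an increment of F. Monotonicity of
    the integral then gives the three bounds. *)
Lemma laplace_poly_sandwich (z delta eta : R) (A B : {poly R}) :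
  0 < z -> 0 < delta < 1 ->
  (forall t, 0 <= t ->
    [/\ expR (- t) * A.[expR (- t)] <= (t <= 1)%R%:R,
        (t <= 1)%R%:R <= expR (- t) * B.[expR (- t)] &
        expR (- t) * B.[expR (- t)] - expR (- t) * A.[expR (- t)] <=
        eta * expR (- t) + (1 - delta < t <= 1 + delta)%R%:R]) ->
  [/\ laplace_poly mu z A <= F z - F 0, F z - F 0 <= laplace_poly mu z B &
      laplace_poly mu z B - laplace_poly mu z A <=
      eta * laplace mu z^-1 + (F ((1 + delta) * z) - F ((1 - delta) * z))].
Proof.
move=> z0 /andP[d0 d1] AB.
have xz (x : R) : D x -> 0 <= x / z.
  by rewrite /= in_itv/= andbT => x0; rewrite divr_ge0// ltW.
have ind (a b x : R) : D x -> (a < x / z <= b)%R%:R = \1_`]a * z, b * z] x :> R.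
  move=> x0; rewrite indicE mem_setE in_itv/= ltr_pdivlMr// ler_pdivrMr//.
have ind1 (x : R) : D x -> (x / z <= 1)%R%:R = \1_`]0, z] x :> R.
  move=> Dx; have x0 : 0 < x by move: Dx; rewrite /= in_itv/= andbT.
  by rewrite indicE mem_setE in_itv/= ler_pdivrMr// mul1r x0.
have z00 : (0 : R) <= 0 <= z.
  by rewrite lexx ltW.
have iA := integrable_exp_horner int_exp A z0.
have iB := integrable_exp_horner int_exp B z0.
have dz : 0 <= (1 - delta) * z <= (1 + delta) * z.
  by rewrite mulr_ge0 ?ler_wpM2r ?(ltW z0)//; lra.
rewrite !laplace_polyE//; split.
- rewrite -Rintegral_indic_oc//; apply: le_Rintegral => //.
    exact: integrable_indic_oc.
  by move=> x x0; rewrite -ind1//; case: (AB _ (xz _ x0)).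
- rewrite -Rintegral_indic_oc//; apply: le_Rintegral => //.
    exact: integrable_indic_oc.
  by move=> x x0; rewrite -ind1//; case: (AB _ (xz _ x0)).
- have iz : mu.-integrable D (fun x => (expR (- z^-1 * x))%:E).
    by apply: int_exp; rewrite invr_gt0.
  have iez : mu.-integrable D (fun x => (eta * expR (- z^-1 * x))%:E).
    by have := integrableZl measurableD eta iz; apply.
  rewrite -RintegralB// -Rintegral_indic_oc// /laplace -RintegralZl//.
  rewrite -RintegralD//; last exact: integrable_indic_oc.
  apply: le_Rintegral => //.
  + exact: (integrableB _ iB iA).
  + exact: (integrableD _ iez (integrable_indic_oc dz)).
  + move=> x x0; rewrite -ind//; have [_ _] := AB _ (xz _ x0).
    by rewrite mulNr [z^-1 * x]mulrC.
Qed.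

End stieltjes_laplace.

(** * Positive operators *)

Section operators.
Variables (R : realType) (B : completeNormedModType R).
Implicit Types (K : set B) (S : B -> B).

Definition bounded_op S := exists M : R, forall v, `|S v| <= M * `|v|.

Let linear_scale S (linS : linear S) (k : R) (x : B) : S (k *: x) = k *: S x.
Proof.
have S0 : S 0 = 0.
  by have := linS (-1) 0 0; rewrite scaleN1r oppr0 addr0 => ->; rewrite scaleN1r addNr.
by rewrite -[k *: x]addr0 linS S0 addr0.
Qed.

(** Boundedness makes the real [sup] in [opnorm] a true upper bound; scaling v to norm 1 then
    suffices. *)
Lemma le_opnorm S (a : R) (v : B) :
  linear S -> bounded_op S -> opnorm S <= a -> `|S v| <= a * `|v|.
Proof.
move=> linS [M SM] Sa; have [->|v0] := eqVneq v 0.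
  by rewrite -(scale0r (0 : B)) linear_scale// !scale0r !normr0 mulr0.
rewrite -ler_pdivrMr ?normr_gt0// (le_trans _ Sa)//.
apply: ub_le_sup; last first.
  exists (`|v|^-1 *: v) => /=.
    by rewrite normrZ normfV normr_id mulVf// normr_eq0.
  by rewrite linear_scale// normrZ normfV normr_id mulrC.
exists `|M| => _ [x /= x1 <-]; rewrite (le_trans (SM _))//.
rewrite (le_trans (ler_wpM2r (normr_ge0 x) (ler_norm M)))//.
by rewrite ler_piMr.
Qed.

Lemma opnorm_le S (a : R) :
  0 <= a -> (forall v, `|S v| <= a * `|v|) -> opnorm S <= a.
Proof.
move=> a0 Sa; apply: ge_sup.
  by exists `|S 0|; exists 0 => //=; rewrite normr0.
by move=> _ [x /= x1 <-]; rewrite (le_trans (Sa _))// ler_piMr.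
Qed.

Lemma continuous_linear_bound (S : {linear B -> B}) : continuous S ->
  exists2 M : R, 0 < M & forall v, `|S v| <= M * `|v|.
Proof.
by move=> /linear_bounded_continuous/linear_boundedP/pinfty_ex_gt0[M M0 SM]; exists M.
Qed.

(* The continuous operators of norm at most 1 on K are pointwise bounded since
   K is generating, hence uniformly bounded. *)
Lemma cone_bound K : nonneg_cone K -> exists2 C : R, 0 < C &
  forall S (a : R), 0 < a -> linear S -> bounded_op S ->
  (forall v, K v -> `|S v| <= a * `|v|) -> forall v, `|S v| <= C * a * `|v|.
Proof.
move=> hK.
pose F := [set S | [/\ linear S, bounded_op S &
                              forall v, K v -> `|S v| <= `|v|]].
have Flin S : F S -> bounded_fun_norm S /\ linear S.
  move=> [linS [M SM] _]; split => // r; exists (`|M| * `|r|) => x xr.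
  rewrite (le_trans (SM _))// (le_trans (ler_wpM2r (normr_ge0 x) (ler_norm M)))//.
  by rewrite ler_wpM2l// (le_trans xr)// ler_norm.
have Fpt : pointwise_bounded F.
  move=> x; have [u [v [Ku Kv ->]]] := cone_generating hK x.
  exists (`|u| + `|v|) => S [linS _ SK].
  have -> : S (u - v) = S u - S v.
    by rewrite addrC -scaleN1r linS scaleN1r addrC.
  by rewrite (le_trans (ler_normB _ _))// lerD// SK.
have [C FC] := @Banach_Steinhauss R B B F Flin Fpt 1.
exists (`|C| + 1); first by rewrite ltr_wpDl.
move=> S a a0 linS [M SM] SKa v.
(* Dividing by [a] brings S into the family to which the uniform bound applies. *)
have FS : F (fun x => a^-1 *: S x).
  split.
  - by move=> k x y; rewrite linS scalerDr !scalerA mulrC.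
  - exists (a^-1 * M) => x; rewrite normrZ gtr0_norm ?invr_gt0// -mulrA.
    by rewrite ler_pM2l ?invr_gt0.
  - by move=> x Kx; rewrite normrZ gtr0_norm ?invr_gt0// ler_pdivrMl// SKa.
have [->|v0] := eqVneq v 0.
  by rewrite -(scale0r (0 : B)) linear_scale// !scale0r !normr0 mulr0.
have := FC _ FS (`|v|^-1 *: v).
rewrite normrZ normfV normr_id mulVf ?normr_eq0// => /(_ (lexx _)).
rewrite linear_scale// !normrZ !normfV normr_id gtr0_norm// ler_pdivrMl//.
rewrite ler_pdivrMl ?normr_gt0// => /le_trans; apply.
rewrite mulrC ler_wpM2r// mulrC ler_wpM2r ?(ltW a0)//.
by rewrite (le_trans (ler_norm _))// lerDl.
Qed.

(** * Laplace sums of a uniformly bounded sequence *)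

Variable T : nat -> {linear B -> B}.
Hypothesis T_bdd : uniformly_bounded T.

Lemma uniformly_bounded_bound : exists2 M : R, 0 < M & forall n v, `|T n v| <= M * `|v|.
Proof.
have [Tc [M TM]] := T_bdd; exists (`|M| + 1); first by rewrite ltr_wpDl.
move=> n v; apply: le_opnorm; [exact: linearP| |].
  by have [N _ TN] := continuous_linear_bound (Tc n); exists N.
by rewrite (le_trans (TM n))// (le_trans (ler_norm _))// lerDl.
Qed.

Let exp_natE (s : R) n : expR (- s * n%:R) = expR (- s) ^+ n.
Proof. by rewrite expRM_natr. Qed.

Let laplace_op_norm (s : R) : 0 < s -> exists2 M : R, 0 < M &
  forall v n, `|expR (- s * n%:R) *: T n v| <= geometric (M * `|v|) (expR (- s)) n.
Proof.
move=> s0; have [M M0 TM] := uniformly_bounded_bound; exists M => // v n.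
rewrite normrZ ger0_norm ?expR_ge0// exp_natE mulrC /geometric/=.
by rewrite ler_wpM2r ?exprn_ge0 ?expR_ge0.
Qed.

Let exp_lt1 (s : R) : 0 < s -> `|expR (- s)| < 1.
Proof. by move=> s0; rewrite ger0_norm ?expR_ge0// -expR0 ltr_expR oppr_lt0. Qed.

(** The norms are dominated by a geometric series of ratio e^-s, and B is complete. This makes the
    [limn] in [laplace_op] a genuine limit. *)
Lemma laplace_op_cvg (s : R) (v : B) : 0 < s ->
  series (fun n => expR (- s * n%:R) *: T n v) @ \oo --> laplace_op T s v.
Proof.
move=> s0; have [M M0 TM] := laplace_op_norm s0.
apply: normed_cvg; apply: (series_le_cvg _ _ (TM v)) => [//|n|].
  by rewrite /geometric/= mulr_ge0 ?exprn_ge0 ?expR_ge0// mulr_ge0// ltW.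
exact/is_cvg_geometric_series/exp_lt1.
Qed.

Lemma laplace_op_linear (s : R) : 0 < s -> linear (laplace_op T s).
Proof.
move=> s0 k u v; apply: cvg_lim => //.
rewrite (_ : series _ = fun n => k *: series (fun n => expR (- s * n%:R) *: T n u) n
   + series (fun n => expR (- s * n%:R) *: T n v) n).
  by apply: cvgD; [apply: cvgZr|]; exact: laplace_op_cvg.
apply/funext => n; rewrite /series/= scaler_sumr -big_split/=.
by apply: eq_bigr => i _; rewrite linearP scalerDr !scalerA mulrC.
Qed.

Lemma laplace_op_bound (s : R) : 0 < s ->
  bounded_op (laplace_op T s).
Proof.
move=> s0; have [M M0 TM] := laplace_op_norm s0.
exists (M / (1 - expR (- s))) => v.
have := cvg_norm (@laplace_op_cvg _ v s0).
have s1 : expR (- s) < 1 by rewrite -expR0 ltr_expR oppr_lt0.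
move=> /(_ _) nT; apply: (closed_cvg _ (@closed_le _ (M / (1 - expR (- s)) * `|v|)) _ _ nT).
near=> n => /=; rewrite /series/= (le_trans (ler_norm_sum _ _ _))//.
apply: (@le_trans _ _ (\sum_(0 <= i < n) geometric (M * `|v|) (expR (- s)) i)).
  by apply: ler_sum => i _; exact: TM.
have := @geometric_seriesE R (M * `|v|) (expR (- s)) (negbT (lt_eqF s1)).
move=> /(congr1 (fun f => f n)); rewrite /series/= => ->.
rewrite [leRHS]mulrAC ler_wpM2r ?invr_ge0 ?subr_ge0 ?(ltW s1)// ler_piMr//.
  by rewrite mulr_ge0// ltW.
Unshelve. all: by end_near. Qed.

Variables (x : R) (x_gt0 : 0 < x).

(** The sum of the T_j with weights e^-t Q(e^-t) at t = j / x, as [laplace_op_poly_cvg] shows. *)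
Definition laplace_op_poly (Q : {poly R}) (v : B) : B :=
  \sum_(k < size Q) Q`_k *: laplace_op T (k.+1%:R / x) v.

Let s_gt0 (k : nat) : 0 < k.+1%:R / x. Proof. by rewrite divr_gt0. Qed.

Lemma laplace_op_poly_linear Q : linear (laplace_op_poly Q).
Proof.
move=> k u v; rewrite /laplace_op_poly scaler_sumr -big_split/=.
apply: eq_bigr => i _.
by rewrite laplace_op_linear// scalerDr !scalerA mulrC.
Qed.

Lemma laplace_op_poly_bound Q : bounded_op (laplace_op_poly Q).
Proof.
have /choice[M hM] := fun k => laplace_op_bound (s_gt0 k).
exists (\sum_(k < size Q) `|Q`_k| * M k) => v.
rewrite /laplace_op_poly (le_trans (ler_norm_sum _ _ _))// mulr_suml.
by apply: ler_sum => k _; rewrite normrZ -mulrA ler_wpM2l.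
Qed.

Lemma laplace_op_poly_cvg Q v :
  series (fun j => (expR (- (j%:R / x)) * Q.[expR (- (j%:R / x))]) *: T j v) @ \oo
  --> laplace_op_poly Q v.
Proof.
rewrite (_ : series _ = fun N => \sum_(k < size Q)
    Q`_k *: series (fun j => expR (- (k.+1%:R / x) * j%:R) *: T j v) N).
  apply: cvg_big => [|k _]; first exact: add_continuous.
  apply: cvgZr; exact: laplace_op_cvg.
apply/funext => N; rewrite /series/=.
under [RHS]eq_bigr do rewrite scaler_sumr.
rewrite exchange_big/=; apply: eq_bigr => j _.
rewrite horner_coef mulr_sumr scaler_suml; apply: eq_bigr => k _.
rewrite scalerA mulrCA -exprS -expRM_natr; congr (_ * expR _ *: _).
by field; rewrite lt0r_neq0.
Qed.

(** The successor makes the half-open range include j = floor x. *)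
Definition sum_op (v : B) : B := \sum_(0 <= j < (Num.truncn x).+1) T j v.

(** Written with weights, the partial sum becomes comparable with the Laplace sums; the series is
    constant once N exceeds floor x. *)
Lemma sum_op_cvg v :
  series (fun j => (j%:R / x <= 1)%R%:R *: T j v) @ \oo --> sum_op v.
Proof.
apply: cvg_near_cst; near=> N.
have xN : ((Num.truncn x).+1 <= N)%N by near: N; exact: nbhs_infty_ge.
rewrite /series/= (big_cat_nat (leq0n _) xN)//= [X in _ + X]big_nat [X in _ + X]big1 ?addr0.
  apply: eq_big_nat => j /andP[_ jx].
  rewrite ler_pdivrMr// mul1r -truncn_ge_nat ?ltW// -ltnS jx scale1r//.
move=> j /andP[jx _].
rewrite ler_pdivrMr// mul1r -truncn_ge_nat ?ltW// leqNgt jx scale0r//.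
Unshelve. all: by end_near. Qed.

(** * Comparison of weighted sums in the cone order *)

Variables (K : set B) (hK : nonneg_cone K).
Hypothesis T_pos : forall n, positive_op K (T n).

(** Partial sums of the difference are nonnegative combinations of the T_j v, hence in K, and K is
    closed. *)
Lemma cone_cvg (f g : nat -> R) (u w v : B) :
  series (fun j => f j *: T j v) @ \oo --> u ->
  series (fun j => g j *: T j v) @ \oo --> w ->
  K v -> (forall j, f j <= g j) -> K (w - u).
Proof.
move=> fu gw Kv fg.
apply: (closed_cvg _ (cone_closed hK) _ _ (cvgB gw fu)).
near=> N; rewrite /series/= !fctE/= -sumrB.
elim/big_ind : _ => [||j _]; [exact: cone0|exact: coneD|].
by rewrite -scalerBl; apply: (coneZ hK); rewrite ?subr_ge0//; exact: T_pos.
Unshelve. all: by end_near. Qed.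

Lemma sum_op_sandwich (P Q : {poly R}) :
  (forall t, 0 <= t ->
    expR (- t) * P.[expR (- t)] <= (t <= 1)%R%:R <= expR (- t) * Q.[expR (- t)]) ->
  forall v, K v -> K (sum_op v - laplace_op_poly P v) /\
                   K (laplace_op_poly Q v - sum_op v).
Proof.
move=> PQ v Kv.
have tj (j : nat) : 0 <= j%:R / x by rewrite divr_ge0// ltW.
split.
- apply: (cone_cvg (@laplace_op_poly_cvg P v) (@sum_op_cvg v)) => // j.
  by have /andP[] := PQ _ (tj j).
- apply: (cone_cvg (@sum_op_cvg v) (@laplace_op_poly_cvg Q v)) => // j.
  by have /andP[] := PQ _ (tj j).
Qed.

End operators.

(** * The Tauberian argument *)

Section op_littleo.
Variables (R : realType) (B : completeNormedModType R) (g : nat -> R).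

(** The estimate ||U_n|| = o(g(n)) stated on vectors, uniformly in v, so that no supremum has to be
    shown finite when estimates are combined. *)
Definition op_littleo (U : nat -> B -> B) : Prop := forall eps : R, 0 < eps ->
  \forall n \near \oo, forall v, `|U n v| <= eps * g n * `|v|.

Lemma op_littleo0 : (\forall n \near \oo, 0 < g n) ->
  op_littleo (fun _ _ => 0).
Proof.
move=> g0 e e0; near=> n => v; rewrite normr0 !mulr_ge0 ?(ltW e0)//.
by apply/ltW; near: n.
Unshelve. all: by end_near. Qed.

Lemma op_littleoD U V : op_littleo U -> op_littleo V ->
  op_littleo (fun n v => U n v + V n v).
Proof.
move=> oU oV e e0; have e2 : 0 < e / 2 by rewrite divr_gt0.
near=> n => v; rewrite (le_trans (ler_normD _ _))//.
rewrite [e]splitr !mulrDl lerD//; move: v.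
  by near: n; exact: oU.
by near: n; exact: oV.
Unshelve. all: by end_near. Qed.

Lemma op_littleoZ (a : R) U : op_littleo U -> op_littleo (fun n v => a *: U n v).
Proof.
move=> oU e e0.
have ea : 0 < e / (`|a| + 1) by rewrite divr_gt0// ltr_wpDl.
near=> n => v.
have Un : `|U n v| <= e / (`|a| + 1) * g n * `|v|.
  by move: v; near: n; exact: oU.
rewrite normrZ (@le_trans _ _ ((`|a| + 1) * `|U n v|))//.
  by rewrite ler_wpM2r// lerDl.
rewrite -ler_pdivlMl ?ltr_wpDl// (_ : _^-1 * _ = e / (`|a| + 1) * g n * `|v|)//.
by ring.
Unshelve. all: by end_near. Qed.

Lemma op_littleo_sum (m : nat) (a : nat -> R) (U : nat -> nat -> B -> B) :
  (\forall n \near \oo, 0 < g n) -> (forall k, op_littleo (U k)) ->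
  op_littleo (fun n v => \sum_(k < m) a k *: U k n v).
Proof.
move=> g0 oU; elim: m => [|m IHm].
  rewrite (_ : (fun _ _ => _) = fun _ _ => 0); first exact: op_littleo0.
  by apply/funext => n; apply/funext => v; rewrite big_ord0.
rewrite (_ : (fun _ _ => _) = fun n v =>
  \sum_(k < m) a k *: U k n v + a m *: U m n v).
  exact: op_littleoD IHm (op_littleoZ (a m) (oU m)).
by apply/funext => n; apply/funext => v; rewrite big_ord_recr.
Qed.

End op_littleo.

Section tauberian.
Variables (R : realType) (B : completeNormedModType R).
Variables (T : nat -> {linear B -> B}) (T_bdd : uniformly_bounded T).
Variables (P : {linear B -> B}) (P_bdd : continuous P).

(** The hypothesis compares the Laplace sum with [cc (s n)] times P; replacing this factor by
    [g n * lam] costs only o(g) because P is bounded. *)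
Lemma laplace_op_littleo (cc : R -> R) (g s : nat -> R) (lam : R) :
  op_equiv 0^'+ (laplace_op T) cc P ->
  (forall n, 0 < s n) -> s @ \oo --> (0 : R) ->
  (\forall n \near \oo, 0 < g n) ->
  cc (s n) / g n @[n --> \oo] --> lam ->
  op_littleo g (fun n v => laplace_op T (s n) v - (g n * lam) *: P v).
Proof.
move=> TP s0 scvg g0 cclam e e0.
have [M M0 PM] := continuous_linear_bound P_bdd.
(* Each of the two errors gets half of e: [e1] absorbs the bound |lam| + 1 on cc / g, and [e2] the
   bound M of P. *)
pose e1 := e / 2 / (`|lam| + 1).
have e10 : 0 < e1 by rewrite !divr_gt0// ltr_wpDl.
pose e2 := e / 2 / M.
have e20 : 0 < e2 by rewrite !divr_gt0.
have scvg' : s @ \oo --> (0 : R)^'+.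
  move=> A /scvg; apply: (@filterS _ \oo _ (fun n => 0 < s n -> A (s n))) => n.
  exact.
have {}TP : \forall n \near \oo,
    opnorm (fun v => laplace_op T (s n) v - cc (s n) *: P v) <= e1 * cc (s n).
  exact: (scvg' _ (TP _ e10)).
near=> n => v.
have gn : 0 < g n by near: n.
have d1 : `|lam - cc (s n) / g n| <= e2.
  by near: n; move/cvgrPdist_le : cclam; apply.
have d2 : `|cc (s n) / g n| <= `|lam| + 1.
  by near: n; move/cvg_norm/cvgr_le : cclam; apply; rewrite ltrDl.
have op1 : `|laplace_op T (s n) v - cc (s n) *: P v| <= e1 * cc (s n) * `|v|.
  apply: (@le_opnorm _ _ (fun v => laplace_op T (s n) v - cc (s n) *: P v)).
  - move=> k u w; rewrite (laplace_op_linear T_bdd (s0 n)) linearP.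
    by rewrite scalerDr opprD addrACA scalerBr !scalerA [k * _]mulrC.
  - have [N TN] := laplace_op_bound T_bdd (s0 n).
    exists (N + `|cc (s n)| * M) => w; rewrite (le_trans (ler_normB _ _))//.
    by rewrite mulrDl lerD// normrZ -mulrA ler_wpM2l.
  - by near: n.
have -> : laplace_op T (s n) v - (g n * lam) *: P v =
    (laplace_op T (s n) v - cc (s n) *: P v) +
    (g n * (cc (s n) / g n - lam)) *: P v.
  by rewrite mulrBr scalerBl addrA mulrCA mulfV ?lt0r_neq0// mulr1 subrK.
rewrite (le_trans (ler_normD _ _))// [e in leRHS]splitr !mulrDl lerD//.
  rewrite (le_trans op1)// ler_wpM2r//.
  rewrite -[cc (s n)](divfK (lt0r_neq0 gn)) mulrA ler_wpM2r ?(ltW gn)//.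
  rewrite -ler_pdivlMl// /e1 invfM invrK mulrAC mulVf ?mul1r ?lt0r_neq0 ?divr_gt0//.
  exact: le_trans (ler_norm _) d2.
rewrite normrZ normrM (gtr0_norm gn) distrC [_ * g n]mulrC -!mulrA.
rewrite ler_wpM2l ?(ltW gn)// (le_trans (ler_pM _ _ d1 (PM v)))//.
by rewrite /e2 !mulrA divfK ?lt0r_neq0.
Unshelve. all: by end_near. Qed.

Variables (K : set B) (hK : nonneg_cone K).
Hypothesis T_pos : forall n, positive_op K (T n).

(** On K the differences S - W Q1 and W Q2 - S are nonnegative, so normality bounds S - W Q1 by the
    small operator W Q2 - W Q1; [cone_bound] extends this to all vectors. *)
Lemma karamata_op (x g : nat -> R) (I : {poly R} -> R) (F : R) :
  (forall n, 0 < x n) -> (\forall n \near \oo, 0 < g n) ->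
  (forall Q, op_littleo g
    (fun n v => laplace_op_poly T (x n) Q v - (g n * I Q) *: P v)) ->
  (forall kappa, 0 < kappa -> exists Q1 Q2 : {poly R},
     [/\ forall t, 0 <= t -> expR (- t) * Q1.[expR (- t)] <= (t <= 1)%R%:R
           <= expR (- t) * Q2.[expR (- t)],
         I Q1 <= F, F <= I Q2 & I Q2 - I Q1 <= kappa]) ->
  op_littleo g (fun n v => sum_op T (x n) v - (g n * F) *: P v).
Proof.
move=> x0 g0 hI hF e e0.
have [M M0 PM] := continuous_linear_bound P_bdd.
have [C C0 hC] := cone_bound hK.
have [N KN] := cone_normal hK.
pose N1 := `|N| + 1.
have N10 : 0 < N1 by rewrite ltr_wpDl.
(* The three terms of the denominator match the three errors at the end: S - W Q1, W Q1 - g I(Q1) P,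
   and g (I(Q1) - F) P. *)
pose kappa := e / (C * N1 * (2 + M) + 1 + M).
have D0 : 0 < C * N1 * (2 + M) + 1 + M by rewrite !addr_gt0// !mulr_gt0// addr_gt0.
have k0 : 0 < kappa by rewrite divr_gt0.
have [Q1 [Q2 [Q12 FQ1 FQ2 Q21]]] := hF _ k0.
near=> n => v.
have gn : 0 < g n by near: n.
have W1 w : `|laplace_op_poly T (x n) Q1 w - (g n * I Q1) *: P w| <= kappa * g n * `|w|.
  by move: w; near: n; exact: hI.
have W2 w : `|laplace_op_poly T (x n) Q2 w - (g n * I Q2) *: P w| <=
    kappa * g n * `|w|.
  by move: w; near: n; exact: hI.
set W := laplace_op_poly T (x n) in W1 W2 *.
pose a := (2 + M) * kappa * g n.
have a0 : 0 < a by apply: mulr_gt0 => //; apply: mulr_gt0 => //; exact: addr_gt0.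
(* Two approximation errors give 2 kappa, and the gap between I Q1 and I Q2 gives M kappa. *)
have W21 w : `|W Q2 w - W Q1 w| <= a * `|w|.
  have -> : W Q2 w - W Q1 w = (W Q2 w - (g n * I Q2) *: P w) -
      (W Q1 w - (g n * I Q1) *: P w) + (g n * (I Q2 - I Q1)) *: P w.
    rewrite mulrBr scalerBl; move: (W Q2 w) (W Q1 w) (_ *: _) (_ *: _) => p q s r.
    by rewrite opprB !addrA (addrAC _ (- q) r) (addrAC _ s r) subrK (addrAC _ (- q)) addrK.
  rewrite (le_trans (ler_normD _ _))//.
  have -> : a * `|w| = (kappa * g n * `|w| + kappa * g n * `|w|) +
      g n * kappa * (M * `|w|) by rewrite /a; ring.
  rewrite lerD//.
    by rewrite (le_trans (ler_normB _ _))// lerD.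
  rewrite normrZ ler_pM// normrM (gtr0_norm gn) ler_wpM2l ?(ltW gn)//.
  by rewrite ger0_norm// subr_ge0 (le_trans FQ1).
have SW w : `|sum_op T (x n) w - W Q1 w| <= C * (N1 * a) * `|w|.
  apply: (hC (fun w => sum_op T (x n) w - W Q1 w)).
  - by rewrite mulr_gt0.
  - move=> k u u'.
    have -> : W Q1 (k *: u + u') = k *: W Q1 u + W Q1 u'.
      exact: laplace_op_poly_linear.
    have -> : sum_op T (x n) (k *: u + u') = k *: sum_op T (x n) u + sum_op T (x n) u'.
      by rewrite /sum_op scaler_sumr -big_split/=; apply: eq_bigr => i _; rewrite linearP.
    by rewrite opprD addrACA scalerBr.
  - have [L WL] := laplace_op_poly_bound T_bdd (x0 n) Q1.
    have [L' L'0 TL'] := uniformly_bounded_bound T_bdd.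
    exists ((Num.truncn (x n)).+1%:R * L' + L) => u.
    rewrite (le_trans (ler_normB _ _))// mulrDl lerD//.
    rewrite /sum_op (le_trans (ler_norm_sum _ _ _))// -mulrA mulr_natl.
    rewrite -[X in _ *+ X]subn0 -sumr_const_nat.
    by apply: ler_sum => i _; exact: TL'.
  - move=> u Ku.
    have [K1 K2] := sum_op_sandwich T_bdd (x0 n) hK T_pos Q12 Ku.
    have {}K2 : K ((W Q2 u - W Q1 u) - (sum_op T (x n) u - W Q1 u)).
      by rewrite opprB addrA subrK.
    rewrite (le_trans (KN _ _ K1 K2))//.
    apply: (@le_trans _ _ (N1 * `|W Q2 u - W Q1 u|)).
      by rewrite ler_wpM2r// (le_trans (ler_norm _))// lerDl.
    by rewrite -mulrA ler_wpM2l// ltW.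
have -> : sum_op T (x n) v - (g n * F) *: P v = (sum_op T (x n) v - W Q1 v) +
   (W Q1 v - (g n * I Q1) *: P v) + (g n * (I Q1 - F)) *: P v.
  by rewrite mulrBr scalerBl !addrA !subrK.
rewrite (le_trans (ler_normD _ _))//.
have -> : e * g n * `|v| = C * (N1 * a) * `|v| + kappa * g n * `|v| +
    g n * kappa * (M * `|v|).
  rewrite /a /kappa; field; exact: lt0r_neq0.
rewrite lerD//.
  by rewrite (le_trans (ler_normD _ _))// lerD.
rewrite normrZ ler_pM// normrM (gtr0_norm gn) ler_wpM2l ?(ltW gn)//.
rewrite distrC ger0_norm ?subr_ge0// (le_trans _ Q21)// lerB//.
Unshelve. all: by end_near. Qed.

End tauberian.

(** * The operator A_rho *)

Section stieltjes_fun_laplace.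
Variables (R : realType) (r rho : R) (rho_gt0 : 0 < rho) (p : R -> R).
Variable pP : Prho r rho p.
Let F := stieltjes_fun rho_gt0 pP.
Let mu : {measure set (measurableTypeR R) -> \bar R} := lebesgue_stieltjes_measure F.

Lemma AopE (s : R) : Aop rho_gt0 pP s = s `^ rho * laplace mu s.
Proof. by []. Qed.

(* A divergent integral has [fine] part 0, so a nonzero value of A_rho p gives
   the integrability. *)
Lemma integrable_exp_Aop (s : R) : Aop rho_gt0 pP s != 0 ->
  mu.-integrable (`]0, +oo[%classic : set (measurableTypeR R))
    (fun x => (expR (- s * x))%:E).
Proof.
rewrite AopE mulf_eq0 negb_or => /andP[_ Ls].
apply/integrableP; split.
  apply/measurable_EFinP.
  have mexp : measurable_fun (`]0, +oo[%classic : set R) (fun x : R => expR (- s * x)).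
    exact: measurableT_comp.
  exact: mexp.
under eq_integral do rewrite gee0_abs ?lee_fin ?expR_ge0//.
rewrite ltey; apply: contra_neq Ls => Loo.
by rewrite /laplace /Rintegral Loo.
Qed.

Lemma stieltjes_fun0 : F 0 = 0.
Proof. by rewrite /F /stieltjes_fun ltxx. Qed.

Lemma stieltjes_fun_gt0 (x : R) : 0 < x -> F x = p x * x `^ rho.
Proof. by rewrite /F /stieltjes_fun => ->. Qed.

Lemma stieltjes_fun_cont (z e : R) : cont_points p z -> 0 < e ->
  exists2 d : R, 0 < d < 1 & F ((1 + d) * z) - F ((1 - d) * z) <= e.
Proof.
move=> [z0 pz] e0.
have Fz : p x * x `^ rho @[x --> z] --> p z * z `^ rho.
  apply: cvgM; first exact: pz.
  have /derivable1_diffP/differentiable_continuous :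
      derivable ((@powR R)^~ rho) z 1.
    by apply: derivable_powR; rewrite in_itv/= z0.
  exact.
have e2 : 0 < e / 2 by rewrite divr_gt0.
move/cvgrPdist_le : Fz => /(_ _ e2) /nbhs_ballP[h /= h0 hF].
(* The bound 1/2 keeps (1 - d) z positive; h / (2 z) keeps both endpoints within h of z. *)
pose d := Num.min (1 / 2) (h / (2 * z)).
have d0 : 0 < d by rewrite lt_min !divr_gt0// mulr_gt0.
have d1 : d <= 1 / 2 by rewrite ge_min lexx.
have dh : d * z < h.
  rewrite (@le_lt_trans _ _ (h / 2))//.
    by rewrite -ler_pdivlMr// -mulrA -invfM ge_min lexx orbT.
  by rewrite ltr_pdivrMr// ltr_pMr// ltr1n.
have dz : 0 < d * z by rewrite mulr_gt0.
exists d; first by rewrite d0/=; lra.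
rewrite !stieltjes_fun_gt0; last 2 first.
- by rewrite mulr_gt0//; lra.
- by rewrite mulr_gt0//; lra.
have H1 := hF ((1 + d) * z); have H2 := hF ((1 - d) * z).
have {}H1 : `|p z * z `^ rho - p ((1 + d) * z) * ((1 + d) * z) `^ rho| <= e / 2.
  apply: H1; rewrite /ball/= mulrDl mul1r opprD addrA subrr sub0r normrN.
  by rewrite gtr0_norm.
have {}H2 : `|p z * z `^ rho - p ((1 - d) * z) * ((1 - d) * z) `^ rho| <= e / 2.
  apply: H2; rewrite /ball/= mulrBl mul1r opprB addrC subrK.
  by rewrite gtr0_norm.
move: H1 H2; rewrite !ler_norml => /andP[H1 _] /andP[_ H2]; lra.
Qed.

End stieltjes_fun_laplace.

(** * Partial sums along the geometric scale c^(n/alpha) z *)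

Unset Implicit Arguments.

Theorem theorem5p2 (R : realType) (B : completeNormedModType R) (K : set B)
    (hK : nonneg_cone K)
    (alpha c : R) (alpha_gt0 : 0 < alpha) (alpha_lt1 : alpha < 1) (c_gt1 : 1 < c)
    (T : nat -> {linear B -> B})
    (T_pos : forall n, positive_op K (T n))
    (T_bdd : uniformly_bounded T)
    (P : {linear B -> B}) (P_bdd : continuous P)
    (l : R -> R) (hl : slowly_varying l)
    (q0 : R -> R) (q0_gt0 : forall s, 0 < s -> 0 < q0 s)
    (q0_Q : Qrho (c `^ alpha^-1) alpha (fun s => (q0 s)^-1))
    (hT : op_equiv 0^'+ (laplace_op T)
            (fun s => (s `^ alpha * l s^-1 * q0 s)^-1) P)
    (p : R -> R)
    (hp : is_Aop_inv (c `^ alpha^-1) alpha_gt0 (fun s => (q0 s)^-1) p) :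
  forall z : R, cont_points p z ->
    op_equiv \oo
      (fun (n : nat) v =>
         \sum_(0 <= j < (Num.truncn (c `^ (n%:R / alpha) * z)).+1) T j v)
      (fun n => c ^+ n * z `^ alpha / l (c `^ (n%:R / alpha) * z) * p z) P.
Proof.
move=> z zp; have z0 : 0 < z by case: zp.
have [pP hA] := hp.
pose mu : {measure set (measurableTypeR R) -> \bar R} :=
  lebesgue_stieltjes_measure (stieltjes_fun alpha_gt0 pP).
have qL s : 0 < s -> (q0 s)^-1 = s `^ alpha * laplace mu s.
  by move=> s0; rewrite -hA.
have int_exp s : 0 < s ->
    mu.-integrable (`]0, +oo[%classic : set (measurableTypeR R))
      (fun x => (expR (- s * x))%:E).
  move=> s0; apply: integrable_exp_Aop; rewrite hA// invr_eq0.
  exact/lt0r_neq0/q0_gt0.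
have c0 : 0 < c by exact: lt_trans c_gt1.
(* The ratio of log-periodicity: x_n = r^n z, and (r^n)^alpha = c^n. *)
pose r := c `^ alpha^-1.
have r0 : 0 < r by exact: powR_gt0.
have r1 : 1 < r.
  have -> : 1 = 1 `^ alpha^-1 by rewrite powR1.
  by rewrite gt0_ltr_powR ?nnegrE ?invr_gt0// ltW.
have rn0 n : 0 < r ^+ n by exact: exprn_gt0.
have rnE n : c `^ (n%:R / alpha) = r ^+ n.
  by rewrite mulrC powRrM powR_mulrn// ltW.
have rnalpha n : (r ^+ n) `^ alpha = c ^+ n.
  rewrite -rnE -powRrM divfK ?lt0r_neq0// powR_mulrn//; exact: ltW.
pose x (n : nat) := r ^+ n * z.
have x0 n : 0 < x n by rewrite mulr_gt0.
pose g (n : nat) := c ^+ n / l (x n).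
have q_per n s : 0 < s -> q0 (s / r ^+ n) = q0 s.
  move=> s0; elim: n => [|n IHn]; first by rewrite expr0 divr1.
  rewrite -IHn; apply: invr_inj.
  rewrite -(Pr_period q0_Q.1) ?divr_gt0//; congr (q0 _)^-1.
  by rewrite exprS -/r; field; rewrite !lt0r_neq0.
have s_cvg (b : R) : 0 < b -> b / x n @[n --> \oo] --> (0 : R).
  move=> b0.
  rewrite (_ : (fun _ => _) = geometric (b / z) r^-1).
    by apply: cvg_geometric; rewrite gtr0_norm ?invr_gt0// invf_lt1.
  apply/funext => n; rewrite /geometric/= /x exprVn; field.
  by rewrite !lt0r_neq0.
have x_cvg : x @ \oo --> +oo.
  apply/gtr0_cvgV0; first exact: nearW.
  apply: cvg_trans (s_cvg 1 ltr01); apply: near_eq_cvg; apply: nearW => n.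
  by rewrite div1r.
have [[X [_ l_gt0]] l_sv] := hl.
have lx_gt0 : \forall n \near \oo, 0 < l (x n).
  near=> n; apply: l_gt0; near: n; move/cvgryPge : x_cvg; exact.
have g_gt0 : \forall n \near \oo, 0 < g n.
  near=> n; rewrite divr_gt0 ?exprn_gt0//; near: n; exact: lx_gt0.
(* At s = (k+1) / x_n, log-periodicity of q0 and [qL] turn the normalization divided by g_n into
   L((k+1)/z) l(x_n) / l(x_n/(k+1)), L being the Laplace transform of dF. Slow variation sends the
   last ratio to 1. *)
have hk k : op_littleo g (fun n v => laplace_op T (k.+1%:R / x n) v -
    (g n * laplace mu (k.+1%:R / z)) *: P v).
  have kx0 n : 0 < k.+1%:R / x n by rewrite divr_gt0.
  apply: (laplace_op_littleo T_bdd P_bdd hT) => //; first exact: s_cvg.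
  have kz0 : 0 < k.+1%:R / z by rewrite divr_gt0.
  have lk : l (k.+1%:R^-1 * x n) / l (x n) @[n --> \oo] --> (1 : R).
    have ik0 : 0 < k.+1%:R^-1 :> R by rewrite invr_gt0.
    exact: (cvg_comp x (fun y => l (k.+1%:R^-1 * y) / l y) x_cvg (l_sv _ ik0)).
  have {}lk : laplace mu (k.+1%:R / z) * (l (k.+1%:R^-1 * x n) / l (x n))^-1
      @[n --> \oo] --> laplace mu (k.+1%:R / z).
    have L1 : laplace mu (k.+1%:R / z) = laplace mu (k.+1%:R / z) * 1^-1.
      by rewrite invr1 mulr1.
    rewrite [X in _ --> X]L1; apply: cvgM; first exact: cvg_cst.
    exact: cvgV.
  apply: cvg_trans lk; apply: near_eq_cvg; near=> n.
  have lxn : 0 < l (x n) by near: n.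
  (* Positivity of l is known only from X on, so x_n has to exceed (k+1) X. *)
  have lkxn : 0 < l (k.+1%:R^-1 * x n).
    apply: l_gt0; rewrite ler_pdivlMl//.
    by near: n; move/cvgryPge : x_cvg; exact.
  have kE : k.+1%:R / x n = (k.+1%:R / z) / r ^+ n.
    by rewrite /x; field; rewrite !lt0r_neq0.
  have -> : (k.+1%:R / x n)^-1 = k.+1%:R^-1 * x n by rewrite invfM invrK.
  rewrite kE q_per// [(_ * q0 _)^-1]invfM qL// powRM ?invr_ge0 ?(ltW (rn0 n)) ?(ltW kz0)//.
  have -> : (r ^+ n)^-1 `^ alpha = (c ^+ n)^-1.
    rewrite -[_^-1 in LHS]powR_inv1 ?(ltW (rn0 n))// powRAC rnalpha.
    by rewrite powR_inv1// exprn_ge0// ltW.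
  rewrite /g; field.
  by rewrite !lt0r_neq0 ?powR_gt0 ?exprn_gt0.
have hQ (Q : {poly R}) : op_littleo g
    (fun n v => laplace_op_poly T (x n) Q v - (g n * laplace_poly mu z Q) *: P v).
  rewrite (_ : (fun _ _ => _) = fun n v => \sum_(k < size Q) Q`_k *:
      (laplace_op T (k.+1%:R / x n) v - (g n * laplace mu (k.+1%:R / z)) *: P v)).
    exact: (op_littleo_sum (size Q) (fun k => Q`_k) g_gt0 hk).
  apply/funext => n; apply/funext => v.
  under [RHS]eq_bigr do rewrite scalerBr scalerA mulrCA.
  by rewrite sumrB -scaler_suml -mulr_sumr.
have hF kappa : 0 < kappa -> exists Q1 Q2 : {poly R},
    [/\ forall t, 0 <= t -> expR (- t) * Q1.[expR (- t)] <= (t <= 1)%R%:R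
          <= expR (- t) * Q2.[expR (- t)],
        laplace_poly mu z Q1 <= p z * z `^ alpha,
        p z * z `^ alpha <= laplace_poly mu z Q2 &
        laplace_poly mu z Q2 - laplace_poly mu z Q1 <= kappa].
  move=> k0; have k2 : 0 < kappa / 2 by rewrite divr_gt0.
  (* Continuity at z makes the increment of F at most kappa / 2; [eta] leaves the other half for the
     exponential error, the added 1 keeping its denominator positive. *)
  have [d d01 dF] := stieltjes_fun_cont alpha_gt0 pP zp k2.
  have L0 : 0 <= laplace mu z^-1 by apply: Rintegral_ge0 => y _; exact: expR_ge0.
  pose eta := kappa / 2 / (laplace mu z^-1 + 1).
  have eta0 : 0 < eta by rewrite divr_gt0// ltr_wpDl.
  have [Q1 [Q2 Q12]] := step_sandwich d01 eta0.
  exists Q1, Q2.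
  have Fz : stieltjes_fun alpha_gt0 pP z - stieltjes_fun alpha_gt0 pP 0 =
      p z * z `^ alpha.
    by rewrite stieltjes_fun0 subr0 stieltjes_fun_gt0.
  have [] := laplace_poly_sandwich int_exp z0 d01 Q12.
  rewrite [X in _ <= X -> _]Fz [X in _ -> X <= _ -> _]Fz => QF1 QF2 QF.
  split => //.
    by move=> t t0; have [-> -> _] := Q12 t t0.
  rewrite (le_trans QF)// [leRHS]splitr lerD//.
  rewrite /eta mulrAC ler_pdivrMr ?ltr_wpDl// ler_wpM2l ?(ltW k2)//.
  by rewrite lerDl.
have pz0 : 0 < p z * z `^ alpha.
  by rewrite mulr_gt0 ?powR_gt0//; exact: (Pr_gt0 (Prho_Pr pP)).
have main := karamata_op T_bdd P_bdd hK T_pos x0 g_gt0 hQ hF.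
move=> e e0; near=> n.
have gn0 : 0 < g n by near: n.
have gE : c ^+ n * z `^ alpha / l (c `^ (n%:R / alpha) * z) * p z =
    g n * (p z * z `^ alpha).
  by rewrite rnE /g /x; ring.
rewrite gE; apply: opnorm_le.
  by apply/ltW/mulr_gt0 => //; exact: mulr_gt0.
move=> v; rewrite rnE.
(* The factor p(z) z^alpha is a positive constant, so it can be moved into the tolerance for g. *)
have -> : e * (g n * (p z * z `^ alpha)) = (e * (p z * z `^ alpha)) * g n by ring.
by move: v; near: n; apply: main; rewrite mulr_gt0.
Unshelve. all: by end_near. Qed.
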